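(* Let $s\ge1$ and let $C$ be an ideal of $\frac{GR(p^2,m)[x]}{\langle x^{p^s}-1\rangle}$ (a cyclic code of length $p^s$ over $GR(p^2,m)$). Let $k,\ell,n<p^s$ be nonnegative integers, with $n<k$ in the items where both $n$ and $k$ occur, and let $\delta(x)=\sum_{j=0}^{k-1-\ell}\eta_j(x-1)^j$ with $\eta_j\in\mathcal{T}_m$ and $\eta_0\ne0$ (so $\ell<k$). Put $z=\min\left(\{j:\gamma_j\ne\eta_j\}\cup\{p^s\}\right)$. In each of the following cases $$d_H(C)=d_H\left(\overline{\langle(x-1)^{T_1(C)}\rangle}\right),$$ where $\overline{\langle(x-1)^{T_1(C)}\rangle}$ is the ideal of $\mathbb{F}_{p^m}[x]/\langle x^{p^s}-1\rangle$ generated by $(x-1)^{T_1(C)}$, and $T_0(C)$, $T_1(C)$ are as follows. (1) If $C=\langle(x-1)^k\rangle$, then $T_0(C)=k$ and $T_1(C)=\min(k,p^{s-1})$. (2) If $C=\langle(x-1)^k+p(x-1)^\ell\delta(x)\rangle$, then $T_0(C)=k$ and $$T_1(C)=\begin{cases}\min(k,p^{s-1},p^s-k+\ell)&\text{if }p^{s-1}\ne p^s-k+\ell,\\ \min(k,p^{s-1}+z)&\text{if }p^{s-1}=p^s-k+\ell.\end{cases}$$ (3) If $C=\langle(x-1)^k,\ p(x-1)^n\rangle$, then $T_0(C)=k$ and $T_1(C)=\min(k,p^{s-1},n)$. (4) If $C=\langle(x-1)^k+p(x-1)^\ell\delta(x),\ p(x-1)^n\rangle$, then $T_0(C)=k$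 and $$T_1(C)=\begin{cases}\min(k,p^{s-1},p^s-k+\ell,n)&\text{if }p^{s-1}\ne p^s-k+\ell,\\ \min(k,p^{s-1}+z,n)&\text{if }p^{s-1}=p^s-k+\ell.\end{cases}$$ (5) If $C=\langle p(x-1)^n\rangle$, then $T_0(C)=p^s$ and $T_1(C)=n$.
   Context: $p$ is a prime, $m\ge1$; $GR(p^2,m)$ is the Galois ring of characteristic $p^2$ with $p^{2m}$ elements, with maximal ideal $\langle p\rangle$ and residue field $\mathbb{F}_{p^m}$; $\mu$ (or a bar) denotes reduction modulo $p$. $\mathcal{T}_m=\{0,1,\zeta,\dots,\zeta^{p^m-2}\}\subset GR(p^2,m)$ is the Teichmüller set ($\zeta$ of multiplicative order $p^m-1$), a set of representatives of $\mathbb{F}_{p^m}$. The elements $\gamma_j\in\mathcal{T}_m$ are defined by: $\gamma_{ip^{s-1}}$ is the element of $\mathcal{T}_m$ congruent modulo $p$ to $\frac1p\binom{p^s}{(i+1)p^{s-1}}$ for $0\le i<p-1$, and $\gamma_j=0$ for all other $j$. (So $x^{p^s}-1=(x-1)^{p^s}+p(x-1)^{p^{s-1}}\sum_{i=0}^{p-2}\gamma_{ip^{s-1}}(x-1)^{ip^{s-1}}$ in $GR(p^2,m)[x]$.) In the definition of $z$, $j$ ranges over $0\le j\le k-1-\ell$. Torsional degrees: for $i\in\{0,1\}$, $\mathrm{Tor}_i(C)=\{\mu(v): p^iv\in C\}$ is an ideal of $\mathbb{F}_{p^m}[x]/\langle x^{p^s}-1\rangle=\mathbb{F}_{p^m}[x]/\langle(x-1)^{p^s}\rangle$,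 hence equals $\langle(x-1)^{T_i}\rangle$ for a unique $0\le T_i\le p^s$; $T_i(C):=T_i$. The Hamming weight $w_H$ of an element of a quotient $A[x]/\langle g\rangle$ ($g$ monic) is the number of nonzero coefficients of its representative of degree less than $\deg g$, and $d_H(C)=\min\{w_H(c):0\ne c\in C\}$. *)

(* Defs.v *)
From HB Require Import structures.
From mathcomp Require Import all_boot all_order all_fingroup all_algebra.

Set Implicit Arguments.
Unset Strict Implicit.
Unset Printing Implicit Defensive.

Import GRing.Theory.
Local Open Scope ring_scope.

(* R is GR(p^2, m): the finite commutative local ring with maximal ideal <p>,
   of characteristic p^2, with p^(2m) elements (unique up to isomorphism). *)
Record is_galois_ring (p m : nat) (R : finComUnitRingType) : Prop := {
  galois_card : #|R| = (p ^ (2 * m))%N;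
  galois_char : forall n : nat, (n%:R == 0 :> R) = (p ^ 2 %| n)%N;
  galois_local : forall a : R,
    reflect (exists b : R, a = p%:R * b) (a \isn't a GRing.unit) }.

(* mu exhibits F as the residue field R/<p>. *)
Record is_reduction (p : nat) (R : finComUnitRingType) (F : finFieldType)
    (mu : {rmorphism R -> F}) : Prop := {
  reduction_surj : forall c : F, exists a : R, mu a = c;
  reduction_ker : forall a : R, mu a = 0 <-> exists b : R, a = p%:R * b }.

Section Teichmuller.
Variables (p m : nat) (R : finComUnitRingType) (F : finFieldType).
Variables (mu : {rmorphism R -> F}) (zeta : R).

Definition teich : {set R} :=
  0 |: [set zeta ^+ i | i : 'I_(p ^ m - 1)].

Definition teich_lift (c : F) : R :=
  odflt 0 [pick t in teich | mu t == c].

Definition gamma (s j : nat) : R :=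
  if (p ^ s.-1 %| j)%N && (j %/ p ^ s.-1 < p.-1)%N
  then teich_lift ('C(p ^ s, (j %/ p ^ s.-1).+1 * p ^ s.-1) %/ p)%:R
  else 0.

End Teichmuller.

Section Ideals.
Variable Q : finComNzRingType.

(* The whole ring is allowed, unlike in the library's idealr. *)
Definition is_ideal (I : {set Q}) : Prop :=
  [/\ 0 \in I, {in I &, forall a b, a + b \in I}
    & forall c a, a \in I -> c * a \in I].

Definition ideal_gen (gs : seq Q) : {set Q} :=
  [set \sum_(i < size gs) a i * gs`_i | a : {ffun 'I_(size gs) -> Q}].

End Ideals.

HB.instance Definition _ (A : finComNzRingType) (h : {poly A}) :=
  Finite.on {poly %/ h}.

(* A[x]/<x^N - 1>, used for N > 0 only ({poly %/ h} is the quotient by 'X when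
   h is a constant). Its elements are the representatives of degree < N. *)
Notation cyc A N := {poly %/ ('X^N - 1 : {poly A})}.

Definition xm1 (A : finComNzRingType) (N : nat) : cyc A N :=
  in_qpoly ('X^N - 1) ('X - 1).

Section Codes.
Variables (A : finComNzRingType) (g : {poly A}).

Definition wH (c : {poly %/ g}) : nat :=
  count (fun a => a != 0) (c : {poly A}).

(* Weights are at most (size g).-1, so the default value matters only for the
   zero code. *)
Definition dH (C : {set {poly %/ g}}) : nat :=
  \big[minn/size g]_(c in C | c != 0) wH c.

End Codes.

Section Torsion.
Variables (p N : nat) (R : finComUnitRingType) (F : finFieldType).
Variable mu : {rmorphism R -> F}.

Definition mu_cyc (v : cyc R N) : cyc F N :=
  in_qpoly ('X^N - 1) (map_poly mu v).

Definition Tor (i : nat) (C : {set cyc R N}) : {set cyc F N} :=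
  [set mu_cyc v | v : cyc R N & p%:R ^+ i * v \in C].

(* The least t <= N such that Tor i C = <(x-1)^t> (N.+1 if there is none); for
   an ideal C and N a power of p there is exactly one such t. *)
Definition tdeg (i : nat) (C : {set cyc R N}) : nat :=
  find (fun t => Tor i C == ideal_gen [:: xm1 F N ^+ t]) (iota 0 N.+1).

End Torsion.

(* Main.v *)
Require Import Defs.
From HB Require Import structures.
From mathcomp Require Import all_boot all_order all_fingroup all_algebra.
From mathcomp Require Import zify ring.

Set Implicit Arguments.
Unset Strict Implicit.
Unset Printing Implicit Defensive.

Import Order.TTheory GRing.Theory Pdiv.Ring Pdiv.RingMonic.
Local Open Scope ring_scope.

(** Put N = p^s, q = p^(s-1), let Q and P be the rings of cyclic codes of length
    N over the Galois ring R and over its residue field F, y and pi the classes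
    of X - 1 in Q and P, and phi : Q -> P the coefficientwise reduction.

    The map phi is a surjective ring morphism, and both its kernel and the
    annihilator of p are pQ. Since X^N - 1 = (X - 1)^N over F, the ring P is a
    chain ring: pi^N = 0, and w pi^k = 0 forces w to be a multiple of
    pi^(N - k).

    Every code of the theorem has the form C = <f, p g> with phi f = pi^k and
    phi g = pi^n: a principal ideal <f> is <f, p f>, and <p y^n> is <0, p y^n>
    with k = N. Then Tor_0 C = <pi^k>. If p v = a f + b p g, reducing modulo p
    shows that phi a annihilates pi^k, so a = a' y^(N - k) + p r; as
    y^(N - k) f = p e for some e, this gives p v = p (a' e + r f + b g), hence
    Tor_1 C = <phi e, pi^k, pi^n> ([torsion1_gen]). So everything reduces to
    writing phi e as a power pi^t times a unit, and then T_1 = min(k, t, n)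
    ([two_generator_code]).

    This power comes from the relation (1 + y)^N = 1. Modulo p^2 only the
    binomials C(N, i) with q | i survive, so y^N = - p y^q G, where G is a
    polynomial in y whose reduced coefficients are those of the gamma_j and
    whose constant coefficient is a unit ([expr_unipotent_expansion],
    [reduction_gamma]). For f = y^k + p y^l delta this yields
    phi e = pi^(N-k+l) phi(delta) - pi^q phi(G), a difference of two powers of
    pi times units. If the exponents differ the smaller one wins; if they agree,
    then phi e = pi^q sum_j (mu eta_j - mu gamma_j) pi^j, and its order is q + z
    because distinct Teichmuller representatives stay distinct modulo p
    ([deformed_xm1_expr_torsion]).

    For the distances, v |-> p v induces a weight-preserving bijection from
    Tor_1 C onto the part of C in pQ, and multiplying a codeword outside pQ by p
    gives a nonzero codeword of no larger weight ([dH_torsion]). *)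

(** * Binomial coefficients of a prime power *)

Section PrimePowerBinomials.
Variables (p s : nat).
Hypothesis p_pr : prime p.
Local Open Scope nat_scope.

(** From i C(p^s, i) = p^s C(p^s - 1, i - 1). *)
Lemma logn_bin_prime_power i : 0 < i <= p ^ s ->
  s <= logn p i + logn p 'C(p ^ s, i).
Proof.
case: i => // i /andP[_ le_i]; have N_gt0 : 0 < p ^ s by rewrite expn_gt0 prime_gt0.
rewrite -lognM ?bin_gt0 // -mul_bin_diag lognM ?bin_gt0 //; last by lia.
by rewrite pfactorK // leq_addr.
Qed.

Lemma dvdn_bin_prime_power i : 0 < i < p ^ s -> p %| 'C(p ^ s, i).
Proof.
move=> /andP[i_gt0 lt_i].
have := logn_bin_prime_power (i := i); rewrite i_gt0 ltnW // => /(_ isT).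
have C_gt0 : 0 < 'C(p ^ s, i) by rewrite bin_gt0 ltnW.
suff lt_log : s <= logn p i + logn p 'C(p ^ s, i) -> 0 < logn p 'C(p ^ s, i).
  by move=> /lt_log; rewrite -(pfactor_dvdn 1 p_pr C_gt0) expn1.
have : logn p i < s.
  rewrite ltnNge -pfactor_dvdn //; apply/negP => /(dvdn_leq i_gt0).
  by rewrite leqNgt lt_i.
lia.
Qed.

Lemma sqr_dvdn_bin_prime_power i :
  i < p ^ s -> ~~ (p ^ s.-1 %| i) -> p ^ 2 %| 'C(p ^ s, i).
Proof.
move=> lt_i ndvd; have i_gt0 : 0 < i by case: i ndvd {lt_i}; rewrite ?dvdn0.
have := logn_bin_prime_power (i := i); rewrite i_gt0 ltnW // => /(_ isT).
have C_gt0 : 0 < 'C(p ^ s, i) by rewrite bin_gt0 ltnW.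
rewrite (pfactor_dvdn 2 p_pr C_gt0).
move: ndvd; rewrite pfactor_dvdn // -ltnNge; lia.
Qed.

(** By Pascal's rule, as p divides C(p^s, i) for 0 < i < p^s, divisibility of
    C(p^s - 1, i) would propagate down to C(p^s - 1, 0) = 1. *)
Lemma ndvdn_bin_pred_prime_power i : i < p ^ s -> ~~ (p %| 'C((p ^ s).-1, i)).
Proof.
elim: i => [|i IHi] lt_i; first by rewrite bin0 dvdn1 neq_ltn prime_gt1 ?orbT.
have := dvdn_bin_prime_power (i := i.+1); rewrite lt_i => /(_ isT).
rewrite -[X in 'C(X, _)]prednK ?(leq_ltn_trans _ lt_i) // binS => dvd_sum.
apply: contra (IHi (ltnW lt_i)) => dvd.
by rewrite -(dvdn_addr _ dvd).
Qed.

Lemma ndvdn_bin_div_prime_power : 0 < s -> ~~ (p %| 'C(p ^ s, p ^ s.-1) %/ p).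
Proof.
move=> s_gt0; have p_gt0 := prime_gt0 p_pr.
set q := p ^ s.-1; have q_gt0 : 0 < q by rewrite expn_gt0 p_gt0.
have NE : p ^ s = p * q by rewrite /q -expnS prednK.
have lt_q : q.-1 < p ^ s.
  by rewrite prednK // NE leq_pmull.
have -> : 'C(p ^ s, q) = 'C((p ^ s).-1, q.-1) * p.
  apply/eqP; rewrite -(eqn_pmul2l q_gt0) -{1 2}(prednK q_gt0) -mul_bin_diag NE.
  by apply/eqP; lia.
by rewrite mulnK // ndvdn_bin_pred_prime_power.
Qed.

End PrimePowerBinomials.

(** Binomial expansion of (y + 1)^(p^s) = 1. The terms y^i with 0 < i < p^(s-1)
    vanish because their coefficients are divisible by p^2; the other ones are
    all divisible by p. The terms whose exponent is not a multiple of p^(s-1) are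
    kept in the sum, which spares a case distinction: their coefficients
    C(p^s, i) / p are themselves divisible by p. *)
Lemma expr_unipotent_expansion (p s : nat) (Q : comNzRingType) (y : Q) :
    prime p -> (0 < s)%N -> (p ^ 2)%:R = 0 :> Q -> (y + 1) ^+ (p ^ s) = 1 ->
  y ^+ (p ^ s) = p%:R * (- (y ^+ (p ^ s.-1) *
    \sum_(j < p ^ s - p ^ s.-1) ('C(p ^ s, j + p ^ s.-1) %/ p)%:R * y ^+ j)).
Proof.
move=> p_pr s_gt0 pp0 unipot; have p_gt0 := prime_gt0 p_pr.
set q := (p ^ s.-1)%N; have q_gt0 : (0 < q)%N by rewrite expn_gt0 p_gt0.
have NE : (p ^ s = p * q)%N by rewrite /q -expnS prednK.
have lt_qN : (q < p ^ s)%N by rewrite NE ltn_Pmull // prime_gt1.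
move: unipot; rewrite addrC exprDn -(big_mkord xpredT
   (fun i => 1 ^+ (p ^ s - i) * y ^+ i *+ 'C(p ^ s, i))).
rewrite big_nat_recr //= binn mulr1n subnn mul1r big_ltn; last by lia.
rewrite subn0 expr1n mul1r expr0 bin0 mulr1n -addrA => /(canRL (addKr _)).
rewrite addNr => /(canRL (addKr _)); rewrite addr0 => ->.
rewrite mulrN; congr (- _).
rewrite (big_cat_nat _ (n := q)) //=; last by lia.
rewrite big_nat_cond big1 ?add0r => [|i /andP[/andP[i_gt0 lt_iq] _]].
  rewrite -{1}[q]add0n big_addn big_mkord !mulr_sumr; apply: eq_bigr => j _.
  have lt_jN : (j + q < p ^ s)%N by have := ltn_ord j; lia.
  have /divnK {1}<- : (p %| 'C(p ^ s, j + q))%N.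
    by apply: dvdn_bin_prime_power => //; rewrite lt_jN; lia.
  rewrite expr1n mul1r -mulr_natl natrM exprD.
  ring.
have ndvd_i : ~~ (q %| i)%N by apply/negP => /(dvdn_leq i_gt0); lia.
have lt_i : (i < p ^ s)%N by lia.
have /dvdnP[c ->] := sqr_dvdn_bin_prime_power p_pr lt_i ndvd_i.
by rewrite -mulr_natl natrM pp0 mulr0 mul0r.
Qed.

(** * Finitely generated ideals *)

Section GeneratedIdeals.
Variable Q : finComNzRingType.
Implicit Types (I : {set Q}) (gs : seq Q) (a b g : Q).

Lemma ideal_gen_is_ideal gs : is_ideal (ideal_gen gs).
Proof.
split=> [|a b /imsetP[u _ ->] /imsetP[v _ ->]|c a /imsetP[u _ ->]].
- apply/imsetP; exists [ffun=> 0] => //.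
  by rewrite big1 // => i _; rewrite ffunE mul0r.
- apply/imsetP; exists [ffun i => u i + v i] => //.
  by rewrite -big_split; apply: eq_bigr => i _; rewrite ffunE mulrDl.
apply/imsetP; exists [ffun i => c * u i] => //.
by rewrite mulr_sumr; apply: eq_bigr => i _; rewrite ffunE mulrA.
Qed.

Lemma mem_ideal_gen gs g : g \in gs -> g \in ideal_gen gs.
Proof.
move=> gs_g; pose j := Ordinal (etrans (index_mem g gs) gs_g).
apply/imsetP; exists [ffun i => (i == j)%:R] => //.
rewrite (bigD1 j) //= ffunE eqxx mul1r nth_index // big1 ?addr0 // => i /negPf.
by rewrite ffunE => ->; rewrite mul0r.
Qed.

Lemma ideal_gen_sub gs I :
  is_ideal I -> {subset gs <= I} -> ideal_gen gs \subset I.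
Proof.
move=> [I0 ID IM] sub; apply/subsetP=> _ /imsetP[u _ ->].
by apply: (big_ind (fun a => a \in I)) => // i _; apply/IM/sub/mem_nth.
Qed.

Lemma eq_ideal_gen gs hs : {subset gs <= ideal_gen hs} ->
  {subset hs <= ideal_gen gs} -> ideal_gen gs = ideal_gen hs.
Proof.
move=> sgh shg; apply/eqP; rewrite eqEsubset.
by rewrite !ideal_gen_sub //; apply: ideal_gen_is_ideal.
Qed.

Lemma mem_ideal_gen1P g a : reflect (exists b, a = b * g) (a \in ideal_gen [:: g]).
Proof.
apply: (iffP imsetP) => [[u _ ->]|[b ->]].
  by exists (u ord0); rewrite big_ord1.
by exists [ffun=> b]; rewrite // big_ord1 ffunE.
Qed.

Lemma mem_ideal_gen2P g h a :
  reflect (exists b c, a = b * g + c * h) (a \in ideal_gen [:: g; h]).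
Proof.
apply: (iffP idP) => [/imsetP[u _ ->]|[b [c ->]]].
  by exists (u ord0), (u (lift ord0 ord0)); rewrite big_ord_recl big_ord1.
have [_ D M] := ideal_gen_is_ideal [:: g; h].
by apply: D; apply: M; apply: mem_ideal_gen; rewrite !inE eqxx ?orbT.
Qed.

(** The powers of x are totally ordered by divisibility, so the least exponent
    generates. *)
Lemma ideal_gen_powers (x u u' : Q) k t n : u * u' = 1 ->
  ideal_gen [:: x ^+ t * u; x ^+ k; x ^+ n] =
  ideal_gen [:: x ^+ minn k (minn t n)].
Proof.
move=> uu'; set d := minn k _.
have dvd i : (d <= i)%N -> exists b, x ^+ i = b * x ^+ d.
  by move=> le_di; exists (x ^+ (i - d)); rewrite -exprD subnK.
have [_ _ M] := ideal_gen_is_ideal [:: x ^+ t * u; x ^+ k; x ^+ n].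
apply: eq_ideal_gen => a; rewrite !inE.
  case/or3P=> /eqP->; apply/mem_ideal_gen1P; try by apply: dvd; lia.
  have [|b ->] := dvd t; first by lia.
  by exists (b * u); rewrite mulrAC.
move=> /eqP->; have : [|| d == k, d == t | d == n] by lia.
case/or3P=> /eqP->; try by apply: mem_ideal_gen; rewrite !inE eqxx ?orbT.
have := M u' _ (mem_ideal_gen (mem_head (x ^+ t * u) [:: x ^+ k; x ^+ n])).
by rewrite mulrCA [u' * u]mulrC uu' mulr1.
Qed.

End GeneratedIdeals.

(** * Torsion ideals along a reduction morphism *)

Section TorsionIdeals.
Variables (Q P : finComNzRingType) (phi : {rmorphism Q -> P}) (p : Q).
Hypothesis phi_surj : forall w, exists v, phi v = w.
Hypothesis phi_ker : forall v, phi v = 0 -> exists w, v = p * w.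
Hypothesis ann_p : forall v, p * v = 0 <-> phi v = 0.

Hypothesis phi_p : phi p = 0.

Lemma torsion0_gen f g :
  [set phi v | v in ideal_gen [:: f; p * g]] = ideal_gen [:: phi f].
Proof.
apply/setP=> w; apply/imsetP/mem_ideal_gen1P => [[v /mem_ideal_gen2P[a [b ->]] ->]|].
  by exists (phi a); rewrite rmorphD !rmorphM phi_p mul0r mulr0 addr0.
case=> b ->; have [a <-] := phi_surj b.
exists (a * f); last by rewrite rmorphM.
by apply/mem_ideal_gen2P; exists a, 0; rewrite mul0r addr0.
Qed.

(** The hypothesis on c says that multiples of phi c are the only relations on
    phi f. Hence an element of <f, p g> is divisible by p exactly when its
    coefficient on f is c times something, plus a multiple of p; the first part
    contributes c f = p e. *)
Lemma torsion1_gen f c e g :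
    (forall w, w * phi f = 0 -> exists w', w = w' * phi c) -> c * f = p * e ->
  [set phi v | v in [pred v | p * v \in ideal_gen [:: f; p * g]]] =
  ideal_gen [:: phi e; phi f; phi g].
Proof.
move=> ann_f cf_pe; have [_ CD CM] := ideal_gen_is_ideal [:: f; p * g].
have [I0 ID IM] := ideal_gen_is_ideal [:: phi e; phi f; phi g].
have Cf : f \in ideal_gen [:: f; p * g] by rewrite mem_ideal_gen ?inE ?eqxx.
have Cg : p * g \in ideal_gen [:: f; p * g].
  by rewrite mem_ideal_gen ?inE ?eqxx ?orbT.
have eq_mod_p v v' : p * v = p * v' -> phi v = phi v'.
  move=> /eqP; rewrite -subr_eq0 -mulrBr => /eqP/ann_p/eqP.
  by rewrite rmorphB subr_eq0 => /eqP.
apply/setP=> w; apply/imsetP/idP => [[v]|].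
  rewrite inE => /mem_ideal_gen2P[a [b vE]] ->.
  have /ann_f[w' phi_a] : phi a * phi f = 0.
    have := congr1 phi vE.
    by rewrite rmorphD !rmorphM phi_p !mul0r mulr0 addr0.
  have [a' a'E] := phi_surj w'.
  have [r rE] : exists r, a - a' * c = p * r.
    by apply: phi_ker; rewrite rmorphB rmorphM phi_a a'E subrr.
  have -> : phi v = phi (a' * e + r * f + b * g).
    apply: eq_mod_p; rewrite vE (canRL (subrK _) rE).
    by rewrite !mulrDr (mulrCA p a') -cf_pe; ring.
  rewrite !rmorphD !rmorphM.
  by apply: (ID); first apply: ID; apply/IM/mem_ideal_gen; rewrite !inE eqxx ?orbT.
have lift v : p * v \in ideal_gen [:: f; p * g] -> phi v \in
    [set phi v | v in [pred v | p * v \in ideal_gen [:: f; p * g]]].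
  by move=> Cv; apply/imsetP; exists v.
move=> Iw; apply/imsetP; move: w Iw; apply/subsetP/ideal_gen_sub.
  split=> [|_ _ /imsetP[u Cu ->] /imsetP[v Cv ->]|d _ /imsetP[v Cv ->]].
  - rewrite -(rmorph0 phi); apply: lift; rewrite mulr0.
    by rewrite -(mul0r f) CM.
  - by rewrite -rmorphD; apply: lift; rewrite mulrDr CD.
  have [r <-] := phi_surj d.
  by rewrite -rmorphM; apply: lift; rewrite mulrCA CM.
move=> w; rewrite !inE => /or3P[] /eqP->; apply: lift => //.
- by rewrite -cf_pe CM.
- by rewrite CM.
Qed.

End TorsionIdeals.

(** * Orders of elements in a ring with a nilpotent element *)

(** Geometric series: u + x w = u (1 - b) with b = - x w u' nilpotent. *)
Lemma unit_add_nil (A : comNzRingType) (x u u' w : A) (N : nat) :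
  x ^+ N = 0 -> u * u' = 1 -> exists v, (u + x * w) * v = 1.
Proof.
move=> x_nil uu'; pose b := - (x * w * u').
exists (u' * \sum_(i < N) b ^+ i).
have /(congr1 (@GRing.opp A)) := subrX1 b N.
rewrite opprB -mulNr opprB exprNn !exprMn x_nil !mul0r mulr0 subr0 => ->.
rewrite mulrA; congr (_ * _).
by rewrite mulrDl uu' /b opprK.
Qed.

(** A polynomial in a nilpotent element is, up to a unit, its lowest monomial. *)
Lemma nil_series_order (F : fieldType) (A : comAlgType F) (x : A) (N D z : nat)
    (c : nat -> F) : x ^+ N = 0 -> (z < D)%N -> c z != 0 ->
    (forall j, (j < z)%N -> c j = 0) ->
  exists u u', \sum_(j < D) c j *: x ^+ j = x ^+ z * u /\ u * u' = 1.
Proof.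
move=> x_nil lt_zD cz0 c_lt0.
have cz_unit : (c z)%:A * (c z)^-1%:A = 1 :> A.
  by rewrite -scalerAl mul1r scalerA mulfV // scale1r.
have [v v_inv] := unit_add_nil
  (\sum_(z.+1 <= j < D) c j *: x ^+ (j - z.+1)) x_nil cz_unit.
do 2!eexists; split; last exact: v_inv.
rewrite -(big_mkord xpredT (fun j => c j *: x ^+ j)).
rewrite (big_cat_nat _ (n := z)) //=; last exact: ltnW.
rewrite big_nat_cond big1 ?add0r => [|j /andP[/andP[_ /c_lt0->]]]; rewrite ?scale0r //.
rewrite big_ltn // mulrDr -scalerAr mulr1; congr (_ + _).
rewrite mulrA -exprSr mulr_sumr big_nat_cond [RHS]big_nat_cond.
apply: eq_bigr => j /andP[/andP[le_zj _] _].
by rewrite -scalerAr -exprD subnKC.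
Qed.

(** Ultrametric principle: when the orders differ, the smaller one is the order
    of the difference. *)
Lemma nil_sub_order (A : comNzRingType) (x u u' v v' : A) (N a b : nat) :
    x ^+ N = 0 -> u * u' = 1 -> v * v' = 1 -> a != b ->
  exists w w', x ^+ a * u - x ^+ b * v = x ^+ minn a b * w /\ w * w' = 1.
Proof.
move=> x_nil uu' vv'; rewrite neq_ltn => /orP[] lt.
  have [w' ww'] := unit_add_nil (- (x ^+ (b - a.+1) * v)) x_nil uu'.
  do 2!eexists; split; last exact: ww'.
  rewrite (minn_idPl (ltnW lt)) mulrN mulrA -exprS mulrBr mulrA -exprD.
  by congr (_ - x ^+ _ * _); lia.
have vv'N : - v * - v' = 1 by rewrite mulrNN.
have [w' ww'] := unit_add_nil (x ^+ (a - b.+1) * u) x_nil vv'N.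
do 2!eexists; split; last exact: ww'.
rewrite (minn_idPr (ltnW lt)) addrC mulrA -exprS mulrDr mulrA -exprD mulrN.
by congr (_ + x ^+ _ * _); lia.
Qed.

(** * Minima of natural numbers *)

Lemma bigminn_geP (I : finType) (x d : nat) (P : pred I) (F : I -> nat) :
  reflect ((d <= x)%N /\ forall i, P i -> (d <= F i)%N)
          (d <= \big[minn/x]_(i | P i) F i)%N.
Proof. by rewrite -Order.NatOrder.minEnat; exact: (@bigmin_geP _ nat I x d P F). Qed.

Lemma bigminn_ordP (D N : nat) (P : pred nat) : (D <= N)%N ->
  let z := \big[minn/N]_(j < D | P j) (j : nat) in
  (z = N /\ forall j, (j < D)%N -> ~~ P j) \/
  [/\ (z < D)%N, P z & forall j, (j < z)%N -> ~~ P j].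
Proof.
move=> le_DN; case: (pickP (fun j : 'I_D => P j)) => [j0 Pj0|P0] z; last first.
  left; split=> [|j lt_jD]; first by rewrite /z big_pred0.
  by rewrite (P0 (Ordinal lt_jD)).
right; have /ex_minnP[i /andP[lt_iD Pi] i_min] : exists i, (i < D)%N && P i.
  by exists j0; rewrite ltn_ord.
have zE : z = i.
  apply/eqP; rewrite eqn_leq; apply/andP; split.
    have [_ z_min] := bigminn_geP N z _ _ (leqnn z).
    exact: (z_min (Ordinal lt_iD)).
  apply/bigminn_geP; split=> [|j Pj]; first by lia.
  by apply: i_min; rewrite ltn_ord.
rewrite zE; split=> // j lt_ji; apply/negP => Pj.
by have := i_min j; rewrite Pj (ltn_trans lt_ji) // => /(_ isT); lia.
Qed.

(** * The quotient by X^N - 1 *)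

Section CyclicQuotient.
Variables (A : finComNzRingType) (N : nat).
Hypothesis N_gt0 : (0 < N)%N.

Lemma mk_monic_XnB1 : mk_monic ('X^N - 1 : {poly A}) = 'X^N - 1.
Proof. by rewrite /mk_monic size_XnsubC // ltnS N_gt0 monicXnsubC. Qed.

Lemma size_mk_monic_XnB1 : size (mk_monic ('X^N - 1 : {poly A})) = N.+1.
Proof. by rewrite mk_monic_XnB1 size_XnsubC. Qed.

Lemma in_qpoly_XnB1 : in_qpoly ('X^N - 1 : {poly A}) ('X^N - 1) = 0.
Proof. by apply: val_inj; rewrite /= mk_monic_XnB1 rmodpp // monicXnsubC. Qed.

Lemma size_cyc (v : cyc A N) : (size (v : {poly A}) <= N)%N.
Proof. by rewrite -ltnS -size_mk_monic_XnB1 size_mk_monic. Qed.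

Lemma in_qpoly_size (r : {poly A}) :
  (size r <= N)%N -> in_qpoly ('X^N - 1) r = r :> {poly A}.
Proof. by move=> le_rN; apply: in_qpoly_small; rewrite size_mk_monic_XnB1. Qed.

Lemma in_qpolyK (v : cyc A N) : in_qpoly ('X^N - 1) v = v.
Proof. by apply/val_inj/in_qpoly_size/size_cyc. Qed.

Lemma in_qpoly_eq0 (r : {poly A}) :
  in_qpoly ('X^N - 1) r = 0 -> exists d, r = d * ('X^N - 1).
Proof.
move/(congr1 val); rewrite /= mk_monic_XnB1 => r0.
have mon : ('X^N - 1 : {poly A}) \is monic by rewrite monicXnsubC.
by exists (rdivp r ('X^N - 1)); rewrite {1}(rdivp_eq mon r) r0 addr0.
Qed.

Lemma xm1_unipotent : (xm1 A N + 1) ^+ N = 1.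
Proof.
rewrite /xm1 -(rmorph1 (in_qpoly ('X^N - 1))) -rmorphD subrK -rmorphXn.
by apply/eqP; rewrite -subr_eq0 -rmorphB /= in_qpoly_XnB1.
Qed.

Lemma wH_sum_coef (v : cyc A N) : wH v = (\sum_(i < N) ((v : {poly A})`_i != 0)%R)%N.
Proof.
rewrite /wH -sum1_count big_mkcond (big_nth 0) big_mkord.
rewrite [RHS](bigID (fun i : 'I_N => (i < size (v : {poly A}))%N)) /=.
rewrite [X in (_ + X)%N]big1 ?addn0 => [|i]; last first.
  by rewrite -leqNgt => /(nth_default 0)->; rewrite eqxx.
rewrite (big_ord_widen_cond N xpredT (fun i => nat_of_bool ((v : {poly A})`_i != 0)%R)).
  by apply: eq_bigr => i _; case: eqP.
exact: size_cyc.
Qed.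

End CyclicQuotient.

(** * Cyclic codes of length p^s over the residue field *)

Section ResidueField.
Variables (F : finFieldType) (p s : nat).
Hypothesis pcharF : p \in [pchar F].
Local Notation N := (p ^ s)%N.
Local Notation pi := (xm1 F N).

Let p_pr : prime p. Proof. exact: pcharf_prime pcharF. Qed.
Let N_gt0 : (0 < N)%N. Proof. by rewrite expn_gt0 prime_gt0. Qed.

Lemma subX1_expr : ('X - 1 : {poly F}) ^+ N = 'X^N - 1.
Proof.
have chX : p \in [pchar {poly F}] by rewrite pchar_poly.
elim: s => [|r IHr]; first by rewrite expn0 !expr1.
rewrite expnSr !exprM IHr -!(pFrobenius_autE chX).
by rewrite pFrobenius_autB_comm ?pFrobenius_aut1 //; apply: commr1.
Qed.

Lemma xm1_nil : pi ^+ N = 0.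
Proof. by rewrite /xm1 -rmorphXn subX1_expr /= in_qpoly_XnB1. Qed.

(** Lifting to polynomials, (X - 1)^N divides w (X - 1)^k, and (X - 1)^k can be
    cancelled since the polynomials over F form a domain. *)
Lemma xm1_ann k (w : cyc F N) : (k <= N)%N -> w * pi ^+ k = 0 ->
  exists w', w = w' * pi ^+ (N - k).
Proof.
move=> le_kN; rewrite -{1}(in_qpolyK N_gt0 w) -rmorphXn -rmorphM.
case/(in_qpoly_eq0 N_gt0) => d wE; exists (in_qpoly _ d).
rewrite -rmorphXn -rmorphM -{1}(in_qpolyK N_gt0 w); congr (in_qpoly _ _).
have X1_neq0 : ('X - 1 : {poly F}) ^+ k != 0 by rewrite expf_neq0 // polyXsubC_eq0.
apply: (mulIf X1_neq0).
by rewrite wE -subX1_expr -mulrA -exprD subnK.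
Qed.

Lemma xm1_expr_neq0 k : (k < N)%N -> pi ^+ k != 0.
Proof.
move=> lt_kN; apply/eqP; rewrite -rmorphXn => /(congr1 val) /=.
rewrite -[rmodp _ _]/(in_qpoly _ _ : {poly F}) in_qpoly_size //.
  by move/eqP; rewrite expf_eq0 polyXsubC_eq0 andbF.
by rewrite size_exp_XsubC.
Qed.

(** If t < t', multiplying pi^t = a pi^t' by pi^(N - t') gives
    pi^(N - (t' - t)) = 0, which contradicts [xm1_expr_neq0]. This is what makes
    torsional degrees unique. *)
Lemma xm1_ideal_inj t t' : (t <= N)%N -> (t' <= N)%N ->
  ideal_gen [:: pi ^+ t] = ideal_gen [:: pi ^+ t'] -> t = t'.
Proof.
wlog lt_tt' : t t' / (t < t')%N => [IH tN t'N eq_tt'|tN t'N eq_tt'].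
  case: (ltngtP t t') => // lt; first exact: IH lt tN t'N eq_tt'.
  exact: esym (IH _ _ lt t'N tN (esym eq_tt')).
have : pi ^+ t \in ideal_gen [:: pi ^+ t'] by rewrite -eq_tt' mem_ideal_gen ?inE.
case/mem_ideal_gen1P => a /(congr1 (fun w => w * pi ^+ (N - t'))).
rewrite -mulrA -!exprD subnKC // xm1_nil mulr0 => /eqP.
by rewrite (negPf (xm1_expr_neq0 _)) //; lia.
Qed.

End ResidueField.

(** * Coefficientwise reduction *)

Section ReductionMorphism.
Variables (N : nat) (R : finComUnitRingType) (F : finFieldType).
Variable mu : {rmorphism R -> F}.

(** For N = 0 both sides are X by the convention of [mk_monic]. *)
Lemma map_poly_mk_monic :
  map_poly mu (mk_monic ('X^N - 1)) = mk_monic ('X^N - 1).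
Proof.
case: (posnP N) => [->|N_gt0]; last first.
  by rewrite !mk_monic_XnB1 // rmorphB /= map_polyXn rmorph1.
by rewrite /mk_monic !expr0 !subrr !size_poly0 /= map_polyX.
Qed.

(** Reduction sends the Euclidean division by X^N - 1 over R to the one over F,
    so it commutes with taking classes; its multiplicativity follows. *)
Lemma mu_cyc_in_qpoly (r : {poly R}) :
  mu_cyc mu (in_qpoly ('X^N - 1) r) = in_qpoly ('X^N - 1) (map_poly mu r).
Proof.
apply: val_inj => /=.
rewrite [in RHS](rdivp_eq (monic_mk_monic ('X^N - 1)) r).
rewrite rmorphD rmorphM /= map_poly_mk_monic.
by rewrite rmodpD ?monic_mk_monic // rmodp_mull ?monic_mk_monic // add0r.
Qed.

Lemma mu_cyc_zmod_morphism : zmod_morphism (mu_cyc mu : cyc R N -> cyc F N).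
Proof. by move=> v w; rewrite /mu_cyc -rmorphB; congr in_qpoly; rewrite -rmorphB. Qed.

Lemma mu_cyc_monoid_morphism : monoid_morphism (mu_cyc mu : cyc R N -> cyc F N).
Proof.
split=> [|v w]; first by rewrite -(rmorph1 (in_qpoly _)) mu_cyc_in_qpoly !rmorph1.
rewrite -[v * w]/(in_qpoly ('X^N - 1) ((v : {poly R}) * (w : {poly R}))).
by rewrite mu_cyc_in_qpoly !rmorphM.
Qed.

HB.instance Definition _ := GRing.isZmodMorphism.Build (cyc R N) (cyc F N)
  (mu_cyc mu : cyc R N -> cyc F N) mu_cyc_zmod_morphism.
HB.instance Definition _ := GRing.isMonoidMorphism.Build (cyc R N) (cyc F N)
  (mu_cyc mu : cyc R N -> cyc F N) mu_cyc_monoid_morphism.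

Lemma mu_cyc_xm1 : mu_cyc mu (xm1 R N) = xm1 F N.
Proof. by rewrite /xm1 mu_cyc_in_qpoly rmorphB /= map_polyX rmorph1. Qed.

Lemma mu_cycZ a (v : cyc R N) : mu_cyc mu (a *: v) = mu a *: mu_cyc mu v.
Proof. by rewrite /mu_cyc -linearZ /= map_polyZ. Qed.

End ReductionMorphism.

(** * Galois rings: reduction modulo p and minimum distance *)

Lemma leq_dHP (A : finComNzRingType) (g : {poly A}) (C : {set {poly %/ g}}) d :
  reflect ((d <= size g)%N /\ forall c, c \in C -> c != 0 -> (d <= wH c)%N)
          (d <= dH C)%N.
Proof.
apply: (iffP (bigminn_geP _ _ _ _)) => -[le_dg le_dC]; split=> // c.
  by move=> Cc c0; apply: le_dC; rewrite Cc.
by case/andP; apply: le_dC.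
Qed.

Section GaloisRing.
Variables (p m : nat) (R : finComUnitRingType) (F : finFieldType).
Variable mu : {rmorphism R -> F}.
Hypotheses (p_pr : prime p) (R_galois : is_galois_ring p m R).
Hypothesis mu_red : is_reduction p mu.

Lemma natr_sqr_eq0 : (p ^ 2)%:R = 0 :> R.
Proof. by case: R_galois => _ charR _; apply/eqP; rewrite charR. Qed.

Lemma reduction_prime : mu p%:R = 0.
Proof. by apply/(reduction_ker mu_red); exists 1; rewrite mulr1. Qed.

Lemma pchar_residue : p \in [pchar F].
Proof. by rewrite inE p_pr -(rmorph_nat mu) reduction_prime eqxx. Qed.

(** In a Galois ring the annihilator of p is the maximal ideal: a unit cannot
    kill p, as the characteristic is p^2. *)
Lemma mulr_prime_eq0 a : (p%:R * a == 0) = (mu a == 0).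
Proof.
case: R_galois => _ charR locR; apply/eqP/eqP => [pa0|]; last first.
  by case/(reduction_ker mu_red) => b ->; rewrite mulrA -natrM mulnn natr_sqr_eq0 mul0r.
apply/(reduction_ker mu_red)/locR; apply/negP => a_unit.
have /eqP : p%:R = 0 :> R by apply: (mulIr a_unit); rewrite mul0r.
by rewrite charR => /(dvdn_leq (prime_gt0 p_pr)); have := prime_gt1 p_pr; nia.
Qed.

Section Cyclic.
Variables (N : nat).
Hypothesis N_gt0 : (0 < N)%N.
Implicit Types v : cyc R N.

Lemma coef_natr_mul (n : nat) v i :
  ((n%:R * v : cyc R N) : {poly R})`_i = n%:R * (v : {poly R})`_i.
Proof.
rewrite !mulr_natl; elim: n => [|n IHn]; first by rewrite !mulr0n coef0.
by rewrite !mulrS coefD IHn.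
Qed.

Lemma coef_mu_cyc v i : (mu_cyc mu v : {poly F})`_i = mu (v : {poly R})`_i.
Proof.
rewrite in_qpoly_size ?coef_map //.
by rewrite (leq_trans (size_poly _ _)) ?size_cyc.
Qed.

Lemma mu_cyc_surj (w : cyc F N) : exists v, mu_cyc mu v = w.
Proof.
pose lift c : R := odflt 0 [pick a | mu a == c].
have liftK c : mu (lift c) = c.
  rewrite /lift; case: pickP => [a /eqP //|no_a].
  by have [a ac] := reduction_surj mu_red c; have := no_a a; rewrite ac eqxx.
exists (in_qpoly _ (\poly_(i < N) lift (w : {poly F})`_i)).
apply/npolyP => i; rewrite coef_mu_cyc in_qpoly_size ?size_poly // coef_poly.
case: ltnP => [_ //|le_Ni].
by rewrite rmorph0 nth_default // (leq_trans _ le_Ni) ?size_cyc.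
Qed.

Lemma mu_cyc_ker v : mu_cyc mu v = 0 -> exists w, v = p%:R * w.
Proof.
move=> v0; pose div a : R := odflt 0 [pick b | a == p%:R * b].
exists (in_qpoly _ (\poly_(i < N) div (v : {poly R})`_i)).
apply/npolyP => i; rewrite coef_natr_mul in_qpoly_size ?size_poly // coef_poly.
case: ltnP => [_|le_Ni]; last first.
  by rewrite mulr0 nth_default // (leq_trans _ le_Ni) ?size_cyc.
rewrite /div; case: pickP => [b /eqP //|no_b].
have /(reduction_ker mu_red)[b vb] : mu (v : {poly R})`_i = 0.
  by rewrite -coef_mu_cyc v0 coef0.
by have := no_b b; rewrite {1}vb eqxx.
Qed.

Lemma mu_cyc_prime : mu_cyc mu (p%:R : cyc R N) = 0.
Proof.
apply/npolyP => i; rewrite -[p%:R]mulr1 coef_mu_cyc coef_natr_mul.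
by rewrite rmorphM reduction_prime mul0r coef0.
Qed.

Lemma mu_cyc_ann v : p%:R * v = 0 <-> mu_cyc mu v = 0.
Proof.
split=> /npolyP v0; apply/npolyP => i; move/eqP: (v0 i); rewrite !coef0.
  by rewrite coef_natr_mul mulr_prime_eq0 coef_mu_cyc => /eqP.
by rewrite coef_mu_cyc coef_natr_mul -mulr_prime_eq0 => /eqP.
Qed.

Lemma wH_prime_mul v : wH (p%:R * v) = wH (mu_cyc mu v).
Proof.
rewrite !wH_sum_coef //; apply: eq_bigr => i _.
by rewrite coef_natr_mul mulr_prime_eq0 coef_mu_cyc.
Qed.

Lemma leq_wH_prime_mul v : (wH (p%:R * v)%R <= wH v)%N.
Proof.
rewrite !wH_sum_coef //; apply: leq_sum => i _; rewrite coef_natr_mul.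
by case: (altP ((v : {poly R})`_i =P 0)) => [->|_]; rewrite ?mulr0 ?eqxx ?leq_b1.
Qed.

(** Multiplication by p identifies Tor_1 C with the codewords in pQ, keeping
    weights; a codeword c outside pQ is dominated by the nonzero codeword p c.
    Both minima have the same default value N + 1, which settles C = 0. *)
Lemma dH_torsion (C : {set cyc R N}) :
  is_ideal C -> dH C = dH (Tor p mu 1 C).
Proof.
case=> _ _ CM; have szE : size ('X^N - 1 : {poly R}) = size ('X^N - 1 : {poly F}).
  by rewrite !size_XnsubC.
apply/eqP; rewrite eqn_leq; apply/andP; split; apply/leq_dHP.
  have [dH_size dH_min] := leq_dHP C _ (leqnn (dH C)).
  split=> [|_ /imsetP[v Cv ->] v0]; first by rewrite -szE.
  rewrite -wH_prime_mul dH_min //; first by move: Cv; rewrite inE expr1.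
  by apply: contraNneq v0 => /mu_cyc_ann->; rewrite eqxx.
have [dH_size dH_min] := leq_dHP (Tor p mu 1 C) _ (leqnn _).
split=> [|c Cc c0]; first by rewrite szE.
have mem_Tor v : p%:R * v \in C -> mu_cyc mu v \in Tor p mu 1 C.
  by move=> Cv; apply/imsetP; exists v; rewrite // inE expr1.
(* Either c = p v, or p c is a nonzero codeword. *)
case: (altP (mu_cyc mu c =P 0)) => [/mu_cyc_ker[v cE]|c_red0].
  rewrite cE wH_prime_mul dH_min ?mem_Tor -?cE //.
  by apply: contraNneq c0 => v0; apply/eqP; rewrite cE; apply/mu_cyc_ann.
by apply: leq_trans (leq_wH_prime_mul c); rewrite wH_prime_mul dH_min // mem_Tor // CM.
Qed.

End Cyclic.

(** * Torsional degrees of two-generator codes *)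

Section PrimePowerLength.
Variables (s : nat).
Local Notation N := (p ^ s)%N.
Local Notation pi := (xm1 F N).
Let N_gt0 : (0 < N)%N. Proof. by rewrite expn_gt0 prime_gt0. Qed.

Lemma tdegE i (C : {set cyc R N}) t : (t <= N)%N ->
  Tor p mu i C = ideal_gen [:: pi ^+ t] -> tdeg p mu i C = t.
Proof.
move=> le_tN TorE; rewrite /tdeg; set a := fun _ => _.
have a_has : has a (iota 0 N.+1).
  by apply/hasP; exists t; rewrite ?mem_iota ?add0n ?ltnS // /a TorE.
have := nth_find 0%N a_has; rewrite has_find size_iota in a_has.
move: a_has; move: (find _ _) => t' lt_t'N; rewrite ltnS in lt_t'N.
rewrite nth_iota // add0n /a TorE => /eqP eq_tt'.
exact: esym (xm1_ideal_inj pchar_residue le_tN lt_t'N eq_tt').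
Qed.

(** The common core of all cases: t is the order at pi of the reduction of
    y^(N - k) f / p. *)
Lemma two_generator_code (C : {set cyc R N}) (f e g : cyc R N)
    (u u' : cyc F N) (k t n : nat) :
    (k <= N)%N -> mu_cyc mu f = pi ^+ k -> mu_cyc mu g = pi ^+ n ->
    xm1 R N ^+ (N - k) * f = p%:R * e -> mu_cyc mu e = pi ^+ t * u -> u * u' = 1 ->
    C = ideal_gen [:: f; p%:R * g] ->
  let T i := tdeg p mu i C in
  [/\ T 0%N = k, T 1%N = minn k (minn t n) &
      dH C = dH (ideal_gen [:: pi ^+ T 1%N])].
Proof.
move=> le_kN fE gE cf_pe eE uu' CE T.
have Tor0 : Tor p mu 0 C = ideal_gen [:: pi ^+ k].
  rewrite -fE -(torsion0_gen (@mu_cyc_surj N N_gt0) (mu_cyc_prime N_gt0) f g) -CE.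
  apply/setP=> w; apply/imsetP/imsetP => -[v Cv ->]; exists v => //.
    by move: Cv; rewrite inE mul1r.
  by rewrite inE mul1r.
have Tor1 : Tor p mu 1 C = ideal_gen [:: pi ^+ minn k (minn t n)].
  rewrite -(ideal_gen_powers _ _ _ _ uu') -eE -fE -gE.
  have ann_f w : w * mu_cyc mu f = 0 ->
      exists w', w = w' * mu_cyc mu (xm1 R N ^+ (N - k)).
    rewrite fE rmorphXn /= mu_cyc_xm1.
    exact: (xm1_ann pchar_residue).
  rewrite -(torsion1_gen (@mu_cyc_surj N N_gt0) (@mu_cyc_ker N N_gt0)
    (@mu_cyc_ann N N_gt0) (mu_cyc_prime N_gt0) g ann_f cf_pe) -CE.
  apply/setP=> w; apply/imsetP/imsetP => -[v Cv ->]; exists v => //.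
    by move: Cv; rewrite !inE expr1.
  by move: Cv; rewrite !inE expr1.
have T1 : T 1%N = minn k (minn t n) by apply: tdegE => //; lia.
split=> //; first exact: tdegE.
by rewrite T1 -Tor1; apply: dH_torsion => //; rewrite CE; apply: ideal_gen_is_ideal.
Qed.

End PrimePowerLength.

(** * Teichmuller representatives and the numbers gamma_j *)

Section Teichmuller.
Variables (s : nat) (zeta : R).
Hypotheses (m_gt0 : (0 < m)%N) (s_gt0 : (0 < s)%N).
Hypothesis zeta_prim : (p ^ m - 1).-primitive_root zeta.
Local Notation teich := (teich p m zeta).

(** x^p - 1 = (x - 1) (1 + x + ... + x^(p-1)), and both factors are divisible
    by p: the second one reduces to p = 0. *)
Lemma expr_prime_unipotent x : mu x = 1 -> x ^+ p = 1.
Proof.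
move=> mux; have /(reduction_ker mu_red)[b bE] : mu (x - 1) = 0.
  by rewrite rmorphB mux rmorph1 subrr.
have /(reduction_ker mu_red)[c cE] : mu (\sum_(i < p) x ^+ i) = 0.
  rewrite rmorph_sum (eq_bigr (fun _ => 1)) => [|i _]; last first.
    by rewrite rmorphXn /= mux expr1n.
  by rewrite sumr_const card_ord (pcharf0 pchar_residue).
apply/eqP; rewrite -subr_eq0 subrX1 bE cE mulrACA -natrM mulnn natr_sqr_eq0.
by rewrite mul0r.
Qed.

(** If mu zeta has order d, then zeta^(d p) = 1 by [expr_prime_unipotent], so
    p^m - 1, which is prime to p, divides d. *)
Lemma reduction_zeta_prim : (p ^ m - 1).-primitive_root (mu zeta).
Proof.
have n_gt0 := prim_order_gt0 zeta_prim.
have mu_zeta1 : mu zeta ^+ (p ^ m - 1) = 1.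
  by rewrite -rmorphXn prim_expr_order ?rmorph1.
have [d d_prim d_dvd] := prim_order_exists n_gt0 mu_zeta1.
suff /eqP -> : (p ^ m - 1)%N == d by [].
rewrite eqn_dvd d_dvd andbT -(@Gauss_dvdl _ _ p).
  rewrite (prim_order_dvd zeta_prim) exprM expr_prime_unipotent //.
  by rewrite rmorphXn prim_expr_order.
rewrite coprime_sym prime_coprime //.
by rewrite dvdn_subr ?expn_gt0 ?prime_gt0 // ?dvdn_exp // dvdn1 neq_ltn prime_gt1 ?orbT.
Qed.

Lemma teich_reduction_inj : {in teich &, injective mu}.
Proof.
have nz i : mu (zeta ^+ i) != 0.
  rewrite rmorphXn expf_neq0 //; apply/eqP => zeta0.
  have /eqP := prim_expr_order reduction_zeta_prim.
  rewrite zeta0 expr0n -leqn0 leqNgt (prim_order_gt0 zeta_prim).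
  by rewrite eq_sym oner_eq0.
move=> a b; rewrite !inE => /orP[/eqP->|/imsetP[i _ ->]] /orP[/eqP->|/imsetP[j _ ->]] //.
- by rewrite rmorph0 => /esym/eqP; rewrite (negPf (nz j)).
- by rewrite rmorph0 => /eqP; rewrite (negPf (nz i)).
rewrite !rmorphXn => /eqP; rewrite (eq_prim_root_expr reduction_zeta_prim).
by rewrite -(eq_prim_root_expr zeta_prim) => /eqP.
Qed.

(** A nonzero element of the prime field is a root of X^(p^m - 1) - 1, hence a
    power of mu zeta. *)
Lemma teich_lift_nat n :
  teich_lift p m mu zeta n%:R \in teich /\ mu (teich_lift p m mu zeta n%:R) = n%:R.
Proof.
rewrite /teich_lift; case: pickP => [t /andP[Tt /eqP]//|/= no_t].
case: (altP (n%:R =P 0 :> F)) => [n0|n_neq0].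
  by have := no_t 0; rewrite !inE eqxx rmorph0 n0 eqxx.
have /(prim_rootP reduction_zeta_prim)[i nE] : n%:R ^+ (p ^ m - 1) = 1 :> F.
  apply: (mulIf n_neq0); rewrite -exprSr mul1r -subSn ?expn_gt0 ?prime_gt0 // subn1 /=.
  elim: (m) => [|r IHr]; first by rewrite expr1.
  by rewrite expnSr exprM IHr -(pFrobenius_autE pchar_residue) pFrobenius_aut_nat.
have := no_t (zeta ^+ i); rewrite rmorphXn -nE eqxx andbT !inE => /negP[].
by apply/orP; right; apply/imsetP; exists i.
Qed.

Lemma gamma_teich j : gamma p m mu zeta s j \in teich.
Proof.
rewrite /gamma; case: ifP => _; last by rewrite !inE eqxx.
exact: proj1 (teich_lift_nat _).
Qed.

(** Below p^s - p^(s-1) the case distinction in the definition of gamma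
    disappears after reduction: where gamma_j is set to 0, the binomial is
    divisible by p^2. *)
Lemma reduction_gamma j : (j < p ^ s - p ^ s.-1)%N ->
  mu (gamma p m mu zeta s j) = ('C(p ^ s, j + p ^ s.-1) %/ p)%:R.
Proof.
have q_gt0 : (0 < p ^ s.-1)%N by rewrite expn_gt0 prime_gt0.
have NE : (p ^ s = p * p ^ s.-1)%N by rewrite -expnS prednK.
move=> lt_j; rewrite /gamma; case: ifP => [/andP[dvd_qj _]|].
  rewrite (proj2 (teich_lift_nat _)).
  by rewrite mulSn divnK // addnC.
have -> : (j %/ p ^ s.-1 < p.-1)%N.
  by rewrite ltn_divLR // -subn1 mulnBl -NE mul1n.
rewrite andbT rmorph0 => /negbT ndvd_qj.
have /dvdnP[c ->] : (p ^ 2 %| 'C(p ^ s, j + p ^ s.-1))%N.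
  apply: sqr_dvdn_bin_prime_power => //; first by lia.
  by rewrite dvdn_addl.
rewrite expnS expn1 mulnA mulnK ?prime_gt0 // natrM.
by rewrite (pcharf0 pchar_residue) mulr0.
Qed.

Local Notation N := (p ^ s)%N.
Local Notation q := (p ^ s.-1)%N.
Local Notation y := (xm1 R N).
Local Notation pi := (xm1 F N).
Let N_gt0 : (0 < N)%N. Proof. by rewrite expn_gt0 prime_gt0. Qed.

(** The series G of the introductory comment. *)
Let quot : cyc R N := \sum_(j < N - q) ('C(N, j + q) %/ p)%:R * y ^+ j.

Let xm1_exprN : y ^+ N = p%:R * (- (y ^+ q * quot)).
Proof.
apply: expr_unipotent_expansion => //; last exact: xm1_unipotent.
by rewrite -mulnn natrM; apply/(mu_cyc_ann N_gt0)/mu_cyc_prime.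
Qed.

Let mu_quot :
  mu_cyc mu quot = \sum_(j < N - q) mu (gamma p m mu zeta s j) *: pi ^+ j.
Proof.
rewrite rmorph_sum; apply: eq_bigr => j _; rewrite reduction_gamma //.
by rewrite rmorphM rmorph_nat rmorphXn /= mu_cyc_xm1 scaler_nat mulr_natl.
Qed.

Let quot_unit : exists u', mu_cyc mu quot * u' = 1.
Proof.
have D_gt0 : (0 < N - q)%N by rewrite subn_gt0 ltn_exp2l ?prime_gt1 // prednK.
have g0 : mu (gamma p m mu zeta s 0) != 0.
  rewrite reduction_gamma // add0n -(dvdn_pcharf pchar_residue).
  exact: ndvdn_bin_div_prime_power.
have [//|u [u' [quotE uu']]] := nil_series_order
  (c := fun j => mu (gamma p m mu zeta s j)) (xm1_nil s pchar_residue) D_gt0 g0.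
by exists u'; rewrite mu_quot quotE expr0 mul1r.
Qed.

(** * Orders of the obstructions *)

Lemma xm1_expr_torsion k : (k <= N)%N -> exists e u u',
  [/\ y ^+ (N - k) * y ^+ k = p%:R * e, mu_cyc mu e = pi ^+ q * u & u * u' = 1].
Proof.
move=> le_kN; have [u' uu'] := quot_unit.
exists (- (y ^+ q * quot)), (- mu_cyc mu quot), (- u'); split.
- by rewrite -exprD subnK.
- by rewrite rmorphN rmorphM rmorphXn /= mu_cyc_xm1 mulrN.
by rewrite mulrNN.
Qed.

(** Here e = y^(N - k + l) delta - y^q G. When both exponents are q, the sums
    for delta and G have the same length k - l = N - q, so no nonzero
    gamma_j lies beyond the range that z inspects; if all the coefficients agree then z = N
    and phi e = 0 = pi^(q + N). *)
Lemma deformed_xm1_expr_torsion k l (eta : nat -> R) :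
    (k < N)%N -> (l < k)%N ->
    (forall j, (j < k - l)%N -> eta j \in teich) -> eta 0%N != 0 ->
  let z := \big[minn/N]_(j < k - l | gamma p m mu zeta s j != eta j) (j : nat) in
  let t := if q != (N - k + l)%N then minn q (N - k + l) else (q + z)%N in
  exists e u u', [/\ y ^+ (N - k) *
      (y ^+ k + p%:R * y ^+ l * \sum_(j < k - l) eta j *: y ^+ j) = p%:R * e,
      mu_cyc mu e = pi ^+ t * u & u * u' = 1].
Proof.
move=> lt_kN lt_lk eta_teich eta0 z t; set delta := \sum_(j < _) _.
have pi_nil := xm1_nil s pchar_residue.
pose e := y ^+ (N - k + l) * delta - y ^+ q * quot.
have eE : y ^+ (N - k) * (y ^+ k + p%:R * y ^+ l * delta) = p%:R * e.
  rewrite mulrDr -exprD subnK 1?ltnW // xm1_exprN /e exprD.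
  ring.
have mu_delta : mu_cyc mu delta = \sum_(j < k - l) mu (eta j) *: pi ^+ j.
  rewrite raddf_sum; apply: eq_bigr => j _.
  by rewrite /= mu_cycZ rmorphXn /= mu_cyc_xm1.
have mu_e : mu_cyc mu e = pi ^+ (N - k + l) * mu_cyc mu delta
                          - pi ^+ q * mu_cyc mu quot.
  by rewrite rmorphB !rmorphM !rmorphXn /= mu_cyc_xm1.
suff [u [u' [eq_e uu']]] : exists u u', mu_cyc mu e = pi ^+ t * u /\ u * u' = 1.
  by exists e, u, u'.
rewrite mu_e /t; case: eqP => [qE|/eqP q_neq] /=; last first.
  have mu_eta0 : mu (eta 0%N) != 0.
    apply: contraNneq eta0 => mu0; apply/eqP/teich_reduction_inj.
    - by apply: eta_teich; rewrite subn_gt0.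
    - by rewrite !inE eqxx.
    by rewrite mu0 rmorph0.
  have D_gt0 : (0 < k - l)%N by rewrite subn_gt0.
  have [//|v [v' [deltaE vv']]] :=
    nil_series_order (c := fun j => mu (eta j)) pi_nil D_gt0 mu_eta0.
  have [w' ww'] := quot_unit.
  rewrite minnC; apply: nil_sub_order pi_nil _ ww' _; last by rewrite eq_sym.
  by rewrite mu_delta deltaE expr0 mul1r; exact: vv'.
have DE : (N - q = k - l)%N by rewrite qE; lia.
rewrite -qE -mulrBr mu_delta mu_quot DE -sumrB.
under eq_bigr do rewrite -scalerBl.
have [|[zE eq_eta]|[lt_z neq_z eq_eta]] := bigminn_ordP (D := k - l) (N := N)
   (fun j => gamma p m mu zeta s j != eta j).
- by lia.
- exists 1, 1; rewrite !mulr1; split=> //; rewrite /z zE exprD pi_nil mulr0.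
  rewrite big1 ?mulr0 // => j _.
  by have := eq_eta j (ltn_ord j); rewrite negbK => /eqP->; rewrite subrr scale0r.
have neq_mu : mu (eta z) - mu (gamma p m mu zeta s z) != 0.
  rewrite subr_eq0; apply: contra neq_z => /eqP eq_mu.
  by apply/eqP/esym/teich_reduction_inj; rewrite ?eta_teich ?gamma_teich.
have [|u [u' [sumE uu']]] := nil_series_order
  (c := fun j => mu (eta j) - mu (gamma p m mu zeta s j)) pi_nil lt_z neq_mu.
  by move=> j /eq_eta; rewrite negbK => /eqP->; rewrite subrr.
by exists u, u'; rewrite sumE exprD mulrA.
Qed.

End Teichmuller.

End GaloisRing.

(** * The theorem *)

Theorem lemma4p8 (p m s : nat) (p_pr : prime p) (m_gt0 : (1 <= m)%N)
    (s_gt0 : (1 <= s)%N)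
    (R : finComUnitRingType) (F : finFieldType) (mu : {rmorphism R -> F})
    (zeta : R)
    (R_galois : is_galois_ring p m R) (mu_red : is_reduction p mu)
    (zeta_prim : (p ^ m - 1).-primitive_root zeta)
    (C : {set cyc R (p ^ s)}) (C_ideal : is_ideal C) :
  let y := xm1 R (p ^ s) in
  let pQ : cyc R (p ^ s) := p%:R in
  let T (i : nat) := tdeg p mu i C in
  let dist_eq :=
    dH C = dH (ideal_gen [:: xm1 F (p ^ s) ^+ T 1%N]) in
  let delta (k l : nat) (eta : nat -> R) : cyc R (p ^ s) :=
    \sum_(j < k - l) eta j *: y ^+ j in
  let delta_ok (k l : nat) (eta : nat -> R) :=
    (forall j, (j < k - l)%N -> eta j \in teich p m zeta) /\ eta 0%N != 0 in
  let z (k l : nat) (eta : nat -> R) : nat :=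
    \big[minn/(p ^ s)%N]_(j < k - l | gamma p m mu zeta s j != eta j) j in
  [/\ (forall k : nat, (k < p ^ s)%N ->
        C = ideal_gen [:: y ^+ k] ->
        [/\ T 0%N = k, T 1%N = minn k (p ^ s.-1) & dist_eq]),
      (forall (k l : nat) (eta : nat -> R),
        (k < p ^ s)%N -> (l < k)%N -> delta_ok k l eta ->
        C = ideal_gen [:: y ^+ k + pQ * y ^+ l * delta k l eta] ->
        [/\ T 0%N = k,
            T 1%N = (if p ^ s.-1 != p ^ s - k + l
                     then minn k (minn (p ^ s.-1) (p ^ s - k + l))
                     else minn k (p ^ s.-1 + z k l eta))%N
          & dist_eq]),
      (forall k n : nat, (k < p ^ s)%N -> (n < k)%N ->
        C = ideal_gen [:: y ^+ k; pQ * y ^+ n] ->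
        [/\ T 0%N = k, T 1%N = minn k (minn (p ^ s.-1) n) & dist_eq]),
      (forall (k l n : nat) (eta : nat -> R),
        (k < p ^ s)%N -> (l < k)%N -> (n < k)%N -> delta_ok k l eta ->
        C = ideal_gen [:: y ^+ k + pQ * y ^+ l * delta k l eta;
                          pQ * y ^+ n] ->
        [/\ T 0%N = k,
            T 1%N = (if p ^ s.-1 != p ^ s - k + l
                     then minn k (minn (p ^ s.-1) (minn (p ^ s - k + l) n))
                     else minn k (minn (p ^ s.-1 + z k l eta) n))%N
          & dist_eq])
    & (forall n : nat, (n < p ^ s)%N ->
        C = ideal_gen [:: pQ * y ^+ n] ->
        [/\ T 0%N = (p ^ s)%N, T 1%N = n & dist_eq])].

Proof.
move=> y pQ T dist_eq delta delta_ok z.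
have muy j : mu_cyc mu (y ^+ j) = xm1 F (p ^ s) ^+ j.
  by rewrite rmorphXn /= mu_cyc_xm1.
have N_gt0 : (0 < p ^ s)%N by rewrite expn_gt0 prime_gt0.
have mupQ : mu_cyc mu pQ = 0 := mu_cyc_prime mu_red N_gt0.
have muf k l eta :
    mu_cyc mu (y ^+ k + pQ * y ^+ l * delta k l eta) = xm1 F (p ^ s) ^+ k.
  by rewrite rmorphD !rmorphM /= mupQ !mul0r addr0 muy.
(* Adding p f brings a principal code to the two-generator form. *)
have gen1 f : ideal_gen [:: f] = ideal_gen [:: f; pQ * f].
  have [_ _ M] := ideal_gen_is_ideal [:: f].
  apply: eq_ideal_gen => a; rewrite !inE.
    by move=> /eqP->; apply: mem_ideal_gen; rewrite inE eqxx.
  case/orP=> /eqP->; first by apply: mem_ideal_gen; rewrite inE.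
  by apply/M/mem_ideal_gen; rewrite inE.
split.
- move=> k lt_kN CE; rewrite gen1 in CE.
  have [e [u [u' [ykE eE uu']]]] := xm1_expr_torsion p_pr R_galois
    mu_red m_gt0 s_gt0 zeta_prim (ltnW lt_kN).
  have [T0 T1 distC] := two_generator_code p_pr R_galois mu_red
    (ltnW lt_kN) (muy k) (muy k) ykE eE uu' CE.
  by split=> //; rewrite [T 1%N]T1; lia.
- move=> k l eta lt_kN lt_lk [eta_teich eta0] CE; rewrite gen1 in CE.
  have [e [u [u' [fE eE uu']]]] := deformed_xm1_expr_torsion p_pr
    R_galois mu_red m_gt0 s_gt0 zeta_prim lt_kN lt_lk eta_teich eta0.
  have [T0 T1 distC] := two_generator_code p_pr R_galois mu_red
    (ltnW lt_kN) (muf k l eta) (muf k l eta) fE eE uu' CE.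
  by split=> //; rewrite [T 1%N]T1 /z; case: ifP => _; lia.
- move=> k n lt_kN lt_nk CE.
  have [e [u [u' [ykE eE uu']]]] := xm1_expr_torsion p_pr R_galois
    mu_red m_gt0 s_gt0 zeta_prim (ltnW lt_kN).
  have [T0 T1 distC] := two_generator_code p_pr R_galois mu_red
    (ltnW lt_kN) (muy k) (muy n) ykE eE uu' CE.
  by split.
- move=> k l n eta lt_kN lt_lk lt_nk [eta_teich eta0] CE.
  have [e [u [u' [fE eE uu']]]] := deformed_xm1_expr_torsion p_pr
    R_galois mu_red m_gt0 s_gt0 zeta_prim lt_kN lt_lk eta_teich eta0.
  have [T0 T1 distC] := two_generator_code p_pr R_galois mu_red
    (ltnW lt_kN) (muf k l eta) (muy n) fE eE uu' CE.
  by split=> //; rewrite [T 1%N]T1 /z; case: ifP => _; lia.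
move=> n lt_nN CE.
(* The zero generator is pi^N modulo p, which gives T_0 = N and t = N. *)
have gen0 : ideal_gen [:: pQ * y ^+ n] = ideal_gen [:: 0; pQ * y ^+ n].
  have [I0 _ _] := ideal_gen_is_ideal [:: pQ * y ^+ n].
  apply: eq_ideal_gen => a; rewrite !inE.
    by move=> /eqP->; apply: mem_ideal_gen; rewrite !inE eqxx orbT.
  by case/orP=> /eqP-> //; apply: mem_ideal_gen; rewrite inE.
have pi_nil := xm1_nil s (pchar_residue p_pr mu_red).
have mu0 : mu_cyc mu (0 : cyc R (p ^ s)) = xm1 F (p ^ s) ^+ (p ^ s).
  by rewrite rmorph0 pi_nil.
have ann0 : y ^+ (p ^ s - p ^ s) * 0 = pQ * 0 by rewrite !mulr0.
have mu0u : mu_cyc mu (0 : cyc R (p ^ s)) = xm1 F (p ^ s) ^+ (p ^ s) * 1.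
  by rewrite mulr1.
rewrite gen0 in CE.
have [T0 T1 distC] := two_generator_code p_pr R_galois mu_red (leqnn _) mu0 (muy n)
  ann0 mu0u (mulr1 1) CE.
by split=> //; rewrite [T 1%N]T1; lia.
Qed.
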